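(* Let $K$ be a field, let $n\geq 1$ be an integer, and let $x,z,y_1,\dots,y_n$ be indeterminates over $K$. Then the generic fiber of the extension $$K[x,y_1,\dots,y_n][[z]]\hookrightarrow K[x,y_1,\dots,y_n]_x[[z]]$$ has dimension $\geq n$.
   Context: $K[x,y_1,\dots,y_n]_x$ denotes the fraction ring $K[x,y_1,\dots,y_n,1/x]$. The generic fiber of an extension of integral domains $R\subseteq S$ is the set of prime ideals $Q$ of $S$ lying over zero in $R$, i.e. with $Q\cap R=0$. Its dimension is the supremum of the lengths $m$ of strictly increasing chains $Q_0\subset Q_1\subset\cdots\subset Q_m$ of prime ideals of $S$ belonging to the generic fiber. *)

(* Defs.v *)
From HB Require Import structures.
From mathcomp Require Import all_boot all_order all_algebra.
From mathcomp Require Import boolp classical_sets constructive_ereal.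
(* The notations of [mpoly] clash with those of [classical_sets]. *)
From mathcomp Require Export -(notations) mpoly.

Set Implicit Arguments.
Unset Strict Implicit.
Unset Printing Implicit Defensive.
Import Order.TTheory GRing.Theory Num.Theory.
Local Open Scope classical_set_scope.
Local Open Scope ring_scope.

Notation "{ 'mpoly' T [ n ] }" := (mpoly n T)
  (at level 0, T, n at level 2, format "{ 'mpoly'  T [ n ] }") : type_scope.
Notation "''X_' i" := (mpolyX _ (mnm1 i))
  (at level 8, i at level 2, format "''X_' i") : ring_scope.

(* [R[[z]]]; [fps_coef f k] is the coefficient of [z^k]. *)
Record fps (R : comNzRingType) := FPS { fps_coef : nat -> R }.

Notation "{ 'fps' R }" := (fps R) (at level 0, format "{ 'fps'  R }")
  : type_scope.

HB.instance Definition _ (R : comNzRingType) := gen_eqMixin {fps R}.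
HB.instance Definition _ (R : comNzRingType) := gen_choiceMixin {fps R}.

Section FpsRing.
Variable R : comNzRingType.
Implicit Types f g h : {fps R}.

Lemma fpsP f g : fps_coef f =1 fps_coef g -> f = g.
Proof. by case: f g => [f] [g] /= /funext ->. Qed.

Definition fps_zero : {fps R} := FPS (fun=> 0).
Definition fps_one : {fps R} := FPS (fun k => (k == 0)%N%:R).
Definition fps_opp f : {fps R} := FPS (fun k => - fps_coef f k).
Definition fps_add f g : {fps R} := FPS (fun k => fps_coef f k + fps_coef g k).
Definition fps_mul f g : {fps R} :=
  FPS (fun k => \sum_(i < k.+1) fps_coef f i * fps_coef g (k - i)).

Fact fps_addA : associative fps_add.
Proof. by move=> f g h; apply: fpsP => k /=; rewrite addrA. Qed.
Fact fps_addC : commutative fps_add.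
Proof. by move=> f g; apply: fpsP => k /=; rewrite addrC. Qed.
Fact fps_add0 : left_id fps_zero fps_add.
Proof. by move=> f; apply: fpsP => k /=; rewrite add0r. Qed.
Fact fps_addN : left_inverse fps_zero fps_opp fps_add.
Proof. by move=> f; apply: fpsP => k /=; rewrite addNr. Qed.

HB.instance Definition _ :=
  GRing.isZmodule.Build {fps R} fps_addA fps_addC fps_add0 fps_addN.

Let trunc N f : {poly R} := \poly_(i < N) fps_coef f i.

Let mul_trunc N f g k : (k < N)%N ->
  fps_coef (fps_mul f g) k = (trunc N f * trunc N g)`_k.
Proof.
move=> ltkN; rewrite coefM /=; apply: eq_bigr => -[i lti] _ /=.
by rewrite !coef_poly (leq_trans lti) // (leq_ltn_trans (leq_subr _ _)).
Qed.

Fact fps_mulA : associative fps_mul.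
Proof.
move=> f g h; apply: fpsP => k.
transitivity (trunc k.+1 f * (trunc k.+1 g * trunc k.+1 h))`_k.
  rewrite coefM; apply: eq_bigr => -[i lti] _.
  by rewrite -mul_trunc ?ltnS ?leq_subr // coef_poly lti.
rewrite mulrA coefM; apply: eq_bigr => -[i lti] _ /=.
by rewrite -mul_trunc // coef_poly ltnS leq_subr.
Qed.
Fact fps_mulC : commutative fps_mul.
Proof.
by move=> f g; apply: fpsP => k; rewrite !(@mul_trunc k.+1) // mulrC.
Qed.
Fact fps_mul1 : left_id fps_one fps_mul.
Proof.
move=> f; apply: fpsP => k /=; rewrite big_ord_recl /= mul1r subn0.
by rewrite big1 ?addr0 // => i _; rewrite mul0r.
Qed.
Fact fps_mulDl : left_distributive fps_mul fps_add.
Proof.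
move=> f g h; apply: fpsP => k /=; rewrite -big_split /=.
by apply: eq_bigr => i _; rewrite mulrDl.
Qed.
Fact fps_one_neq0 : fps_one != 0.
Proof.
by apply/eqP => /(congr1 (fun h => fps_coef h 0%N))/eqP; rewrite /= oner_eq0.
Qed.

HB.instance Definition _ := GRing.Zmodule_isComNzRing.Build {fps R}
  fps_mulA fps_mulC fps_mul1 fps_mulDl fps_one_neq0.

End FpsRing.

Section FpsMap.
Variables (R S : comNzRingType) (phi : {rmorphism R -> S}).

Definition fps_map (f : {fps R}) : {fps S} := FPS (fun k => phi (fps_coef f k)).

Fact fps_map_zmod_morphism : zmod_morphism fps_map.
Proof. by move=> f g; apply: fpsP => k /=; rewrite rmorphB. Qed.
Fact fps_map_monoid_morphism : monoid_morphism fps_map.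
Proof.
split=> [|f g]; apply: fpsP => k /=; first by rewrite rmorph_nat.
by rewrite rmorph_sum; apply: eq_bigr => i _; rewrite rmorphM.
Qed.

HB.instance Definition _ :=
  GRing.isZmodMorphism.Build {fps R} {fps S} fps_map fps_map_zmod_morphism.
HB.instance Definition _ :=
  GRing.isMonoidMorphism.Build {fps R} {fps S} fps_map fps_map_monoid_morphism.

Lemma fps_map_inj : injective phi -> injective fps_map.
Proof.
move=> phiI f g eq_fg; apply: fpsP => k; apply: phiI.
exact: (congr1 (fun h => fps_coef h k) eq_fg).
Qed.

End FpsMap.

(* The localization [R_s = R[1/s]] of a domain [R], as the subring
   [{p / s^k}] of its fraction field. *)
Section Localization.
Variables (R : idomainType) (s : R).
Local Notation "a %:F" := (@FracField.tofrac R a).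

Definition loc_pred : {pred {fraction R}} :=
  fun a => `[< exists p k, a = p%:F / s%:F ^+ k >].

Fact loc_pred_tofrac p : p%:F \in loc_pred.
Proof. by apply/asboolP; exists p, 0%N; rewrite expr0 divr1. Qed.

Fact loc_pred_subring : subring_closed loc_pred.
Proof.
have [s0|s0] := eqVneq s 0.
  have locE a : a \in loc_pred -> exists p, a = p%:F.
    case/asboolP => p [[|k] ->]; first by exists p; rewrite expr0 divr1.
    by exists 0; rewrite s0 !rmorph0 expr0n /= invr0 mulr0.
  by split=> [|_ _ /locE[p ->] /locE[q ->]|_ _ /locE[p ->] /locE[q ->]];
    rewrite -?(rmorph1, rmorphB, rmorphM) loc_pred_tofrac.
have sk0 k : s%:F ^+ k != 0 by rewrite expf_neq0 // tofrac_eq0.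
split=> [|_ _ /asboolP[p [k ->]] /asboolP[q [l ->]]
         |_ _ /asboolP[p [k ->]] /asboolP[q [l ->]]].
- by rewrite -(rmorph1 (@FracField.tofrac R)) loc_pred_tofrac.
- apply/asboolP; exists (p * s ^+ l - q * s ^+ k), (k + l)%N.
  rewrite rmorphB !rmorphM !rmorphXn exprD /= -[- (q%:F / _)]mulNr.
  by rewrite addf_div // mulNr.
- apply/asboolP; exists (p * q), (k + l)%N.
  by rewrite rmorphM exprD mulf_div.
Qed.

HB.instance Definition _ :=
  GRing.isSubringClosed.Build {fraction R} loc_pred loc_pred_subring.

Record loc := Loc { loc_val : {fraction R}; _ : loc_val \in loc_pred }.

HB.instance Definition _ := [isSub for loc_val].
HB.instance Definition _ := [Choice of loc by <:].
HB.instance Definition _ := [SubChoice_isSubComNzRing of loc by <:].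

Definition to_loc (p : R) : loc := Loc (loc_pred_tofrac p).

Fact to_loc_zmod_morphism : zmod_morphism to_loc.
Proof. by move=> p q; apply: val_inj; rewrite rmorphB /= rmorphB. Qed.
Fact to_loc_monoid_morphism : monoid_morphism to_loc.
Proof.
by split=> [|p q]; apply: val_inj; rewrite ?(rmorph1, rmorphM) /= ?(rmorph1, rmorphM).
Qed.

HB.instance Definition _ :=
  GRing.isZmodMorphism.Build R loc to_loc to_loc_zmod_morphism.
HB.instance Definition _ :=
  GRing.isMonoidMorphism.Build R loc to_loc to_loc_monoid_morphism.

Lemma to_loc_inj : injective to_loc.
Proof. by move=> p q [/eqP]; rewrite tofrac_eq => /eqP. Qed.

End Localization.

Section GenericFiber.
Variables (R S : comNzRingType) (phi : {rmorphism R -> S}).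

Definition genericFiber : set (prime_idealr S) :=
  [set Q | phi @^-1` [set` Q] = [set 0]].

Definition genericFiberChain (m : nat) (Q : 'I_m.+1 -> prime_idealr S) : Prop :=
  (forall i, genericFiber (Q i)) /\
  (forall i j : 'I_m.+1, (i < j)%N -> [set` Q i] `<` [set` Q j]).

(* The supremum is taken among the extended integers; it is [-oo] for an empty
   fiber. *)
Definition genericFiberDim : \bar int :=
  supremum -oo%E
    [set (m%:Z)%:E | m in [set m : nat | exists Q, @genericFiberChain m Q]].

End GenericFiber.

(* Main.v *)
Require Import Defs.
From HB Require Import structures.
From mathcomp Require Import all_boot all_order all_algebra.
From mathcomp Require Import boolp classical_sets constructive_ereal.
Set Implicit Arguments.
Unset Strict Implicit.
Unset Printing Implicit Defensive.
Import Order.TTheory GRing.Theory Num.Theory.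
Local Open Scope ring_scope.

(** Write [x, y_1, ..., y_n] for the variables and [S = K[x,y]_x[[z]]]. Replacing
    [y_1, ..., y_t] by power series [f_1, ..., f_t] of [K[x]_x[[z]]] is an
    endomorphism of [S], and its kernel [Q_t] is prime because [S] is a domain.
    These kernels increase with [t], strictly because [y_(t+1) - f_(t+1)] lies
    in [Q_(t+1)] and not in [Q_t]. So [Q_0, ..., Q_n] is a chain of length [n],
    and it lies in the generic fiber as soon as no nonzero element of
    [K[x,y][[z]]] is killed when all the [f_t] are substituted ([tower_inj]).

    The elements of [K[x,y][[z]]] have coefficients without poles at [x = 0], and
    the [f_t] are chosen to have poles that are too sparse to cancel: [f_t] is
    the sum of the [x^-a_k z^k], where each [a_k] is huge compared with
    [a_(k-1)]. If [F (y := f) = 0] with [F] nonzero, let [g] be the truncation of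
    [f] after [z^k]. On the one hand, the Taylor expansion of [F] at [f] shows
    that [F (y := g)] has a coefficient [c x^(- m a_(k+1))] with [m > 0] and [c]
    nonzero, both independent of [k], at a power [z^N] with [N <= (k+1)^2]. On
    the other hand, the poles of [g] are of order at most [a_k], so that the
    pole order of this coefficient is bounded in terms of [N], [a_k] and [F]. This
    is absurd for large [k] ([fps_subst_lac_eq0]). The argument only uses a bound
    [P k] for the pole order of the coefficient of [z^k] in [F], given before
    [f] is chosen; since substituting [f] yields such a bound again
    ([poles_le_subst]), the [f_t] can be chosen one after the other. *)

(** * Formal power series *)

Section PowerSeries.
Variable R : comNzRingType.
Implicit Types (f g : {fps R}) (c : R).

Lemma fps_coefD f g k : fps_coef (f + g) k = fps_coef f k + fps_coef g k.
Proof. by []. Qed.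
Lemma fps_coefN f k : fps_coef (- f) k = - fps_coef f k. Proof. by []. Qed.
Lemma fps_coefM f g k :
  fps_coef (f * g) k = \sum_(i < k.+1) fps_coef f i * fps_coef g (k - i).
Proof. by []. Qed.
Lemma fps_coef_sum (I : Type) (r : seq I) (P : pred I) (F : I -> {fps R}) k :
  fps_coef (\sum_(i <- r | P i) F i) k = \sum_(i <- r | P i) fps_coef (F i) k.
Proof. by elim/big_rec2: _ => // i _ g _ <-. Qed.

Lemma fps_neq0P f : f != 0 -> exists2 k, fps_coef f k != 0 &
  forall i, (i < k)%N -> fps_coef f i = 0.
Proof.
move=> f0; have ex : exists k, fps_coef f k != 0.
  apply: contrapT => no; case/eqP: f0; apply: fpsP => k.
  by apply/eqP/negPn/negP => fk; apply: no; exists k.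
case: (ex_minnP ex) => k fk kmin; exists k => // i ik.
by apply/eqP/negPn/negP => /kmin; rewrite leqNgt ik.
Qed.

Definition fpsC c : {fps R} := FPS (fun k => if k == 0%N then c else 0).

Lemma fps_coefC c k : fps_coef (fpsC c) k = if k == 0%N then c else 0.
Proof. by []. Qed.

Lemma fps_coefCM c f k : fps_coef (fpsC c * f) k = c * fps_coef f k.
Proof.
rewrite fps_coefM big_ord_recl subn0 big1 ?addr0 // => i _.
by rewrite fps_coefC /= mul0r.
Qed.

Fact fpsC_zmod_morphism : zmod_morphism fpsC.
Proof.
move=> a b; apply: fpsP => k; rewrite fps_coefD fps_coefN !fps_coefC.
by case: ifP; rewrite ?subr0.
Qed.
Fact fpsC_monoid_morphism : monoid_morphism fpsC.
Proof.
split=> [|a b]; apply: fpsP => k; last first.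
  by rewrite fps_coefCM !fps_coefC; case: ifP; rewrite ?mulr0.
by rewrite fps_coefC /=; case: eqP.
Qed.
HB.instance Definition _ :=
  GRing.isZmodMorphism.Build R {fps R} fpsC fpsC_zmod_morphism.
HB.instance Definition _ :=
  GRing.isMonoidMorphism.Build R {fps R} fpsC fpsC_monoid_morphism.

(** Multiplication by the variable [z]. *)
Definition fps_shift f : {fps R} :=
  FPS (fun k => if k is i.+1 then fps_coef f i else 0).
Definition fps_tail f : {fps R} := FPS (fun k => fps_coef f k.+1).

Lemma fps_head_tail f : f = fpsC (fps_coef f 0) + fps_shift (fps_tail f).
Proof.
apply: fpsP => k; rewrite fps_coefD fps_coefC.
by case: k => [|k] /=; rewrite ?addr0 ?add0r.
Qed.

Lemma fps_shiftMl f g : fps_shift f * g = fps_shift (f * g).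
Proof.
apply: fpsP => -[|k]; first by rewrite fps_coefM big_ord1 mul0r.
by rewrite fps_coefM big_ord_recl mul0r add0r.
Qed.

Lemma fps_coefM_order f g i j :
    (forall k, (k < i)%N -> fps_coef f k = 0) ->
    (forall k, (k < j)%N -> fps_coef g k = 0) ->
  fps_coef (f * g) (i + j) = fps_coef f i * fps_coef g j
  /\ forall k, (k < i + j)%N -> fps_coef (f * g) k = 0.
Proof.
move=> f0 g0; split=> [|k kij].
  have ltij : (i < (i + j).+1)%N by rewrite ltnS leq_addr.
  rewrite fps_coefM (bigD1 (Ordinal ltij)) //= addKn big1 ?addr0 // => -[k kP].
  rewrite -val_eqE /= neq_ltn => /orP[/f0->|ik]; first by rewrite mul0r.
  by rewrite g0 ?mulr0 // ltn_subLR // addnC -ltn_subRL addnK.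
rewrite fps_coefM big1 // => -[l lP] _ /=.
have [/f0->|il] := ltnP l i; first by rewrite mul0r.
rewrite g0 ?mulr0 // ltn_subLR //; apply: leq_trans kij _.
by rewrite leq_add2r.
Qed.

Lemma fps_coefX_order f j l : (forall k, (k < j)%N -> fps_coef f k = 0) ->
  fps_coef (f ^+ l) (l * j) = fps_coef f j ^+ l
  /\ forall k, (k < l * j)%N -> fps_coef (f ^+ l) k = 0.
Proof.
move=> f0; elim: l => [|l [IHc IH0]]; first by rewrite !expr0 mul0n.
rewrite !exprS mulSn -IHc; exact: fps_coefM_order.
Qed.

Lemma fps_integral :
    (forall a b : R, a * b = 0 -> a = 0 \/ b = 0) ->
  forall f g, f * g = 0 -> f = 0 \/ g = 0.
Proof.
move=> domR f g fg0; have [->|/fps_neq0P[i fi f0]] := eqVneq f 0; first by left.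
have [->|/fps_neq0P[j gj g0]] := eqVneq g 0; first by right.
have [] := fps_coefM_order f0 g0; rewrite fg0 => /esym/domR[] /eqP.
  by rewrite (negPf fi).
by rewrite (negPf gj).
Qed.

End PowerSeries.

(** * Identifying two power series variables *)

Section Collapse.
Variable R : comNzRingType.
Implicit Types (f g : {fps {fps R}}) (c : {fps R}).

(** The map [R[[z]][[w]] -> R[[z]]] that sends [w] to [z]; it exists because the
    series that are summed have increasing order in [z]. *)
Definition fps_collapse f : {fps R} :=
  FPS (fun k => \sum_(i < k.+1) fps_coef (fps_coef f i) (k - i)).

Lemma fps_coef_collapse f k :
  fps_coef (fps_collapse f) k = \sum_(i < k.+1) fps_coef (fps_coef f i) (k - i).
Proof. by []. Qed.

Fact fps_collapse_zmod_morphism : zmod_morphism fps_collapse.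
Proof.
by move=> f g; apply: fpsP => k; rewrite fps_coefD fps_coefN -sumrN -big_split.
Qed.
HB.instance Definition _ := GRing.isZmodMorphism.Build {fps {fps R}} {fps R}
  fps_collapse fps_collapse_zmod_morphism.

Lemma fps_collapseC c : fps_collapse (fpsC c) = c.
Proof.
apply: fpsP => k; rewrite fps_coef_collapse big_ord_recl subn0 big1 ?addr0 //.
Qed.

Lemma fps_collapse_shift f :
  fps_collapse (fps_shift f) = fps_shift (fps_collapse f).
Proof.
apply: fpsP => -[|k]; first by rewrite fps_coef_collapse big_ord1.
by rewrite fps_coef_collapse big_ord_recl add0r.
Qed.

Let fps_collapseD : {morph fps_collapse : f g / f + g}.
Proof. exact: raddfD. Qed.

Let fps_collapseE f : fps_collapse f =
  fps_coef f 0 + fps_shift (fps_collapse (fps_tail f)).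
Proof.
by rewrite {1}[f]fps_head_tail fps_collapseD fps_collapseC fps_collapse_shift.
Qed.

(** By induction on the coefficient: splitting [f] into its constant term and
    [w] times its tail moves the claim from [f] to the tail, one coefficient
    lower. *)
Lemma fps_collapseCM c f : fps_collapse (fpsC c * f) = c * fps_collapse f.
Proof.
have tailE g : fps_tail (fpsC c * g) = fpsC c * fps_tail g.
  by apply: fpsP => k; rewrite [LHS]fps_coefCM fps_coefCM.
apply: fpsP => k; elim: k f => [|k IH] f; rewrite fps_collapseE tailE;
  rewrite fps_coefCM [fps_collapse f]fps_collapseE mulrDr !fps_coefD;
  rewrite [c * fps_shift _]mulrC fps_shiftMl [_ * c]mulrC //.
congr (_ + _); exact: IH.
Qed.

(** The same induction, now on the left factor. *)
Fact fps_collapse_monoid_morphism : monoid_morphism fps_collapse.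
Proof.
split=> [|f g]; first by rewrite -[RHS]fps_collapseC rmorph1.
apply: fpsP => k; elim: k f => [|k IH] f; rewrite {1}[f]fps_head_tail;
  rewrite [fps_collapse f]fps_collapseE !mulrDl fps_collapseD fps_shiftMl;
  rewrite fps_collapseCM fps_collapse_shift !fps_coefD fps_shiftMl //.
congr (_ + _); exact: IH.
Qed.
HB.instance Definition _ := GRing.isMonoidMorphism.Build {fps {fps R}} {fps R}
  fps_collapse fps_collapse_monoid_morphism.

Lemma fps_collapse_map_fpsC c : fps_collapse (fps_map (@fpsC R) c) = c.
Proof.
apply: fpsP => k; rewrite fps_coef_collapse big_ord_recr subnn /= big1 ?add0r //.
by move=> -[i ik] _ /=; rewrite subn_eq0 leqNgt ik.
Qed.

End Collapse.

(** * The localization and its pole orders *)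

Section LocalizationTheory.
Variables (R : idomainType) (s : R).
Local Notation A := (loc s).

Fact loc_inv_subproof : (FracField.tofrac s)^-1 \in loc_pred s.
Proof. by apply/asboolP; exists 1, 1%N; rewrite rmorph1 mul1r expr1. Qed.
Definition loc_inv : A := Loc loc_inv_subproof.

Lemma loc_mulV : s != 0 -> to_loc s s * loc_inv = 1.
Proof. by move=> s0; apply: val_inj => /=; rewrite mulfV // tofrac_eq0. Qed.

Lemma loc_fracP (a : A) : s != 0 ->
  exists p k, to_loc s s ^+ k * a = to_loc s p.
Proof.
move=> s0; case: a => a aP; have /asboolP[p [k aE]] := aP.
exists p, k; apply: val_inj; rewrite rmorphM rmorphXn /= aE mulrC mulfVK //.
by rewrite expf_neq0 // tofrac_eq0.
Qed.

Lemma loc_integral (a b : A) : a * b = 0 -> a = 0 \/ b = 0.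
Proof.
move=> /(congr1 val)/eqP; rewrite /= mulf_eq0 => /orP[]/eqP ab0;
  by [left; apply: val_inj | right; apply: val_inj].
Qed.

Section Extension.
Variables (C : comNzRingType) (phi : {rmorphism R -> C}) (v : C).
Hypothesis phi_sV : phi s * v = 1.

Let s_neq0 : s != 0.
Proof.
apply/eqP => s0; have /eqP := phi_sV.
by rewrite s0 rmorph0 mul0r eq_sym oner_eq0.
Qed.

Definition loc_ext (a : A) : C :=
  let p := cid (loc_fracP a s_neq0) in
  phi (projT1 p) * v ^+ projT1 (cid (projT2 p)).

Let phiXV k : phi s ^+ k * v ^+ k = 1.
Proof. by rewrite -exprMn phi_sV expr1n. Qed.

(** The value does not depend on the chosen fraction, since [phi s] is a unit. *)
Lemma loc_extP a p k : to_loc s s ^+ k * a = to_loc s p ->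
  loc_ext a = phi p * v ^+ k.
Proof.
move=> ap; rewrite /loc_ext; case: cid => q /= ex_l; case: cid => l /= aq.
have pq : s ^+ k * q = s ^+ l * p.
  by apply: (@to_loc_inj _ s); rewrite !rmorphM !rmorphXn /= -aq -ap mulrCA.
rewrite -[LHS]mulr1 -(phiXV k) mulrACA [phi q * _]mulrC -rmorphXn -rmorphM pq.
by rewrite rmorphM rmorphXn mulrACA phiXV mul1r.
Qed.

Lemma loc_ext_to_loc p : loc_ext (to_loc s p) = phi p.
Proof. by rewrite (@loc_extP _ p 0) ?expr0 ?mulr1 ?mul1r. Qed.

Fact loc_ext_zmod_morphism : zmod_morphism loc_ext.
Proof.
move=> a b; have [p [k ap]] := loc_fracP a s_neq0.
have [q [l bq]] := loc_fracP b s_neq0.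
rewrite (loc_extP ap) (loc_extP bq).
rewrite (@loc_extP _ (s ^+ l * p - s ^+ k * q) (k + l)).
  rewrite rmorphB !rmorphM !rmorphXn mulrBl exprD; congr (_ - _).
    by rewrite [_ * phi p]mulrC mulrACA phiXV mulr1.
  by rewrite mulrACA phiXV mul1r.
rewrite rmorphB !rmorphM !rmorphXn /= -ap -bq mulrBr exprD; congr (_ - _).
  by rewrite mulrCA mulrA.
by rewrite mulrA.
Qed.

Fact loc_ext_monoid_morphism : monoid_morphism loc_ext.
Proof.
split=> [|a b]; first by rewrite -(rmorph1 (to_loc s)) loc_ext_to_loc rmorph1.
have [p [k ap]] := loc_fracP a s_neq0; have [q [l bq]] := loc_fracP b s_neq0.
rewrite (loc_extP ap) (loc_extP bq) (@loc_extP _ (p * q) (k + l)).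
  by rewrite rmorphM exprD mulrACA.
by rewrite rmorphM /= -ap -bq exprD mulrACA.
Qed.
HB.instance Definition _ :=
  GRing.isZmodMorphism.Build A C loc_ext loc_ext_zmod_morphism.
HB.instance Definition _ :=
  GRing.isMonoidMorphism.Build A C loc_ext loc_ext_monoid_morphism.

Lemma loc_ext_inv : loc_ext loc_inv = v.
Proof.
by rewrite (@loc_extP _ 1 1) ?expr1 ?rmorph1 ?mul1r // loc_mulV.
Qed.

End Extension.

(** The element [a] of [R[1/s]] has a pole of order at most [m] along [s]. *)
Definition pole_le (m : nat) (a : A) : Prop :=
  exists q, to_loc s s ^+ m * a = to_loc s q.

Lemma pole_le_to_loc p : pole_le 0 (to_loc s p).
Proof. by exists p; rewrite mul1r. Qed.

Lemma pole_leW m l a : (m <= l)%N -> pole_le m a -> pole_le l a.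
Proof.
move=> /subnKC <- [p ap]; exists (s ^+ (l - m) * p).
by rewrite rmorphM rmorphXn /= -ap exprD [_ ^+ m * _]mulrC mulrA.
Qed.

Lemma pole_le0 m : pole_le m 0.
Proof. by exists 0; rewrite mulr0 rmorph0. Qed.

Lemma pole_leD m a b : pole_le m a -> pole_le m b -> pole_le m (a + b).
Proof.
by move=> [p ap] [q bq]; exists (p + q); rewrite mulrDr ap bq rmorphD.
Qed.

Lemma pole_leM m l a b : pole_le m a -> pole_le l b -> pole_le (m + l) (a * b).
Proof.
by move=> [p ap] [q bq]; exists (p * q); rewrite exprD mulrACA ap bq rmorphM.
Qed.

Lemma pole_le_sum m (I : Type) (r : seq I) (F : I -> A) :
  (forall i, pole_le m (F i)) -> pole_le m (\sum_(i <- r) F i).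
Proof.
by move=> Fm; elim/big_ind: _ => //; [exact: pole_le0 | exact: pole_leD].
Qed.

Lemma pole_le_inv k : s != 0 -> pole_le k (loc_inv ^+ k).
Proof. by move=> s0; exists 1; rewrite -exprMn loc_mulV // expr1n rmorph1. Qed.

(** Dividing a nonzero element by higher and higher powers of [s] creates
    poles eventually, when no nonzero element of [R] is divisible by all powers
    of [s]. *)
Lemma pole_le_div_eq0 (a : A) : s != 0 ->
    (forall p, p != 0 -> exists k, forall q, p != s ^+ k * q) ->
    (forall k0, exists2 k, (k0 <= k)%N & pole_le 0 (a * loc_inv ^+ k)) ->
  a = 0.
Proof.
move=> s0 sep apole; have [p [l ap]] := loc_fracP a s0.
have sV k : to_loc s s ^+ k * loc_inv ^+ k = 1.
  by rewrite -exprMn loc_mulV ?expr1n.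
have [p0|/sep[k pk]] := eqVneq p 0.
  by rewrite -[a]mul1r -(sV l) -mulrA mulrCA ap p0 rmorph0 mulr0.
have [k' lek [q]] := apole k; rewrite mul1r => aq.
case/eqP: (pk (s ^+ (k' - k) * (s ^+ l * q))); apply: (@to_loc_inj _ s).
rewrite mulrA -exprD subnKC // !rmorphM !rmorphXn /= -ap -aq.
by rewrite mulrCA; congr (_ * _); rewrite mulrCA sV mulr1.
Qed.

Definition poles_le (P : nat -> nat) (u : {fps A}) : Prop :=
  forall k, pole_le (P k) (fps_coef u k).

(** For a superadditive [P] the series whose [k]-th coefficient has a pole of
    order at most [P k] are closed under products; this is why every bound on
    poles below is kept superadditive. *)
Definition superadditive (P : nat -> nat) : Prop :=
  forall i j, (P i + P j <= P (i + j))%N.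

Lemma superadditive_homo P : superadditive P -> {homo P : i j / (i <= j)%N}.
Proof.
by move=> Psup i j /subnKC <-; apply: leq_trans (Psup _ _); rewrite leq_addr.
Qed.

Lemma poles_leW P Q u : (forall k, P k <= Q k)%N -> poles_le P u -> poles_le Q u.
Proof. by move=> PQ uP k; apply: pole_leW (uP k). Qed.

Lemma poles_le1 P : poles_le P 1.
Proof.
move=> k; apply: pole_leW (leq0n _) _.
by exists (k == 0)%:R; rewrite mul1r rmorph_nat.
Qed.

Lemma poles_leM P u v :
  superadditive P -> poles_le P u -> poles_le P v -> poles_le P (u * v).
Proof.
move=> Psup uP vP k; rewrite fps_coefM; apply: pole_le_sum => -[i ik].
apply: pole_leW (pole_leM (uP i) (vP _)).
by apply: leq_trans (Psup _ _) _; rewrite /= subnKC.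
Qed.

Lemma poles_leX P u l : superadditive P -> poles_le P u -> poles_le P (u ^+ l).
Proof.
move=> Psup uP; elim: l => [|l IH]; first exact: poles_le1.
by rewrite exprS; apply: poles_leM.
Qed.

End LocalizationTheory.

(** * Substituting a power series for a variable *)

Section Substitution.
(** The model is a polynomial ring [R] with a variable [y]: then [rho] writes an
    element of [R] as a polynomial in [y] with coefficients in the other
    variables, and evaluation at [y] undoes this. In general, an element is
    regarded as constant, or free of [y], when [rho] maps it to a constant
    polynomial. *)
Variables (R : idomainType) (s y : R) (rho : {rmorphism R -> {poly R}}).
Hypotheses (s_neq0 : s != 0) (rho_s : rho s = s%:P).
Hypothesis rhoK : forall p, (rho p).[y] = p.
Local Notation A := (loc s).
Local Notation toA := (to_loc s).
Local Notation sV := (loc_inv s).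

Fact loc_rho_subproof : (map_poly toA \o rho) s * sV%:P = 1.
Proof. by rewrite /= rho_s map_polyC /= -polyCM loc_mulV. Qed.

Definition loc_rho : A -> {poly A} := loc_ext loc_rho_subproof.
HB.instance Definition _ := GRing.RMorphism.copy loc_rho
  (loc_ext loc_rho_subproof).

Lemma loc_rho_to_loc p : loc_rho (toA p) = map_poly toA (rho p).
Proof. exact: loc_ext_to_loc. Qed.

Lemma loc_rho_inv : loc_rho sV = sV%:P.
Proof. exact: loc_ext_inv. Qed.

Lemma loc_rho_s k : loc_rho (toA s ^+ k) = (toA s ^+ k)%:P.
Proof. by rewrite rmorphXn /= loc_rho_to_loc rho_s map_polyC /= polyC_exp. Qed.

Lemma loc_rhoK a : (loc_rho a).[toA y] = a.
Proof.
have [p [k ap]] := loc_fracP a s_neq0.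
have sVk : toA s ^+ k * sV ^+ k = 1 by rewrite -exprMn loc_mulV ?expr1n.
rewrite -[LHS]mul1r -[RHS]mul1r -sVk ![_ * sV ^+ k]mulrC -!mulrA; congr (_ * _).
rewrite ap -(rhoK p) -horner_map /= -loc_rho_to_loc -ap rmorphM /= loc_rho_s.
by rewrite hornerCM.
Qed.

Lemma pole_le_loc_rho m a d : pole_le m a -> pole_le m (loc_rho a)`_d.
Proof.
move=> [q aq]; exists (rho q)`_d.
by rewrite -coef_map -loc_rho_to_loc -aq rmorphM /= loc_rho_s coefCM.
Qed.

Definition poly_fpsC (a : A) : {poly {fps A}} := map_poly (@fpsC A) (loc_rho a).
HB.instance Definition _ := GRing.RMorphism.copy poly_fpsC
  (map_poly (@fpsC A) \o loc_rho).

(** The endomorphism of [R[1/s][[z]]] that replaces [y] by the series [th] and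
    fixes [z]: each coefficient, written as a polynomial in [y] by [rho], becomes
    a series in [z], and the resulting series in two variables is collapsed. *)
Definition fps_subst (th : {fps A}) : {rmorphism {fps A} -> {fps A}} :=
  @fps_collapse A \o fps_map (horner_eval th \o poly_fpsC).

Lemma fps_substE th u N : fps_coef (fps_subst th u) N =
  \sum_(k < N.+1) fps_coef (poly_fpsC (fps_coef u k)).[th] (N - k).
Proof. by []. Qed.

Lemma fps_subst_id th u :
  (forall k, loc_rho (fps_coef u k) = (fps_coef u k)%:P) -> fps_subst th u = u.
Proof.
move=> uC; rewrite -[RHS]fps_collapse_map_fpsC; congr (fps_collapse _).
by apply: fpsP => k; rewrite /= /horner_eval /poly_fpsC uC map_polyC hornerC.
Qed.

Lemma fps_substC th a : loc_rho a = a%:P -> fps_subst th (fpsC a) = fpsC a.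
Proof.
have C0 : loc_rho 0 = 0%:P by rewrite polyC0 rmorph0.
move=> aC; apply: fps_subst_id => -[|k]; [exact: aC | exact: C0].
Qed.

Lemma fps_subst_var th : rho y = 'X -> fps_subst th (fpsC (toA y)) = th.
Proof.
move=> rho_y; rewrite -[RHS]fps_collapseC; congr (fps_collapse _).
apply: fpsP => -[|k]; rewrite /= /horner_eval; last by rewrite rmorph0 horner0.
by rewrite /poly_fpsC loc_rho_to_loc rho_y !map_polyX hornerX.
Qed.

Lemma poles_le_subst P th u : superadditive P ->
  poles_le P th -> poles_le P u -> poles_le P (fps_subst th u).
Proof.
move=> Psup thP uP N; rewrite fps_substE; apply: pole_le_sum => -[k kN] /=.
rewrite horner_coef fps_coef_sum; apply: pole_le_sum => d.
rewrite coef_map fps_coefCM.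
apply: pole_leW (pole_leM (pole_le_loc_rho _ (uP k)) (poles_leX _ Psup thP _)).
by apply: leq_trans (Psup _ _) _; rewrite subnKC.
Qed.

(** The [l]-th Hasse derivative of [u] with respect to [y], with [th]
    substituted for [y]. Hasse derivatives keep Taylor's formula valid in every
    characteristic. *)
Definition fps_hasse (th : {fps A}) l (u : {fps A}) : {fps A} :=
  fps_collapse (FPS (fun k => (poly_fpsC (fps_coef u k))^`N(l).[th])).

(** The bound [M] exists for each [N], although the degrees in [y] of the
    coefficients of [u] need not be bounded. *)
Lemma fps_subst_taylor th w u N M :
    (forall k, (k <= N)%N -> (size (poly_fpsC (fps_coef u k)) <= M)%N) ->
  fps_coef (fps_subst (th + w) u) N =
  \sum_(l < M) fps_coef (fps_hasse th l u * w ^+ l) N.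
Proof.
move=> sizeM; rewrite fps_substE.
under eq_bigr => k _.
  rewrite (@nderiv_taylor_wide _ M) ?sizeM -1?ltnS //; last exact: mulrC.
  rewrite fps_coef_sum.
  over.
rewrite exchange_big; apply: eq_bigr => l _.
rewrite mulrC -fps_collapseCM fps_coef_collapse; apply: eq_bigr => k _.
by rewrite fps_coefCM mulrC.
Qed.

(** Let [z^k] be the first power of [z] in [u], and [d] the degree in [y] of its
    coefficient. The [d]-th Hasse derivative of this coefficient is the constant
    polynomial given by its leading coefficient; so the latter is the
    coefficient of [z^k] in the substituted derivative, whatever [th] is. *)
Lemma fps_hasse_neq0 th u : u != 0 -> exists l, fps_hasse th l u != 0.
Proof.
move=> /fps_neq0P[k uk u0]; set p := loc_rho (fps_coef u k).
have p0 : p != 0.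
  apply: contra uk => /eqP pE; rewrite -[fps_coef u k]loc_rhoK -/p pE.
  by rewrite horner0.
exists (size p).-1; apply: contra p0 => /eqP/(congr1 (fun f => fps_coef f k)).
rewrite fps_coef_collapse big_ord_recr /= subnn.
rewrite big1 => [|[i ik] _ /=]; last first.
  by rewrite u0 // rmorph0 raddf0 horner0.
have -> : (poly_fpsC (fps_coef u k))^`N((size p).-1) = (fpsC (lead_coef p))%:P.
  apply/polyP => i; rewrite coef_nderivn coefC coef_map -/p /=.
  case: i => [|i]; first by rewrite addn0 binn.
  rewrite nth_default ?rmorph0 ?mul0rn //.
  by rewrite addnS -addSn; apply: leq_trans (leqSpred _) (leq_addr _ _).
by rewrite add0r hornerC /= => /eqP; rewrite lead_coef_eq0.
Qed.

End Substitution.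

(** * Series with sparse pole orders *)

Section Lacunary.
Variables (R : idomainType) (s : R).
Hypothesis s_neq0 : s != 0.
Local Notation A := (loc s).
Local Notation sV := (loc_inv s).
Variable P : nat -> nat.
Hypothesis Psup : superadditive P.

(** The summand [P (k ^ 2) + k ^ 2 * lac_exp (k - 1)] bounds the pole orders that
    a series bounded by [P] and the terms of [lac] before [z^k] can produce in
    the coefficients of [z^N], for all [N <= k ^ 2]; the summand [k] makes the
    excess tend to infinity. *)
Fixpoint lac_exp (k : nat) : nat :=
  if k is i.+1 then (P (k ^ 2) + k ^ 2 * lac_exp i + k)%N else 0%N.

Lemma lac_exp_homo : {homo lac_exp : i j / (i <= j)%N}.
Proof.
apply: homo_leq => [//|i j k|k]; first exact: leq_trans.
rewrite /= -addnA addnCA; apply: leq_trans (leq_addr _ _).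
by rewrite leq_pmull // expn_gt0.
Qed.

Lemma lac_exp_gap k N : (N <= k.+1 ^ 2)%N ->
  (P N + N * lac_exp k + k.+1 <= lac_exp k.+1)%N.
Proof.
by move=> Nk; rewrite leq_add2r leq_add ?leq_mul2r ?Nk ?orbT ?superadditive_homo.
Qed.

Definition lac : {fps A} := FPS (fun k => sV ^+ lac_exp k).

(** A superadditive bound that dominates both [P] and the pole orders of [lac];
    the factor [k] makes it superadditive. *)
Definition lac_pole (k : nat) : nat := (k * (P k + lac_exp k))%N.

Lemma lac_pole_superadditive : superadditive lac_pole.
Proof.
have homo i j : (i <= j)%N -> (P i + lac_exp i <= P j + lac_exp j)%N.
  by move=> ij; rewrite leq_add ?lac_exp_homo ?superadditive_homo.
by move=> i j; rewrite /lac_pole mulnDl leq_add // leq_mul // homo //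
  ?leq_addr ?leq_addl.
Qed.

Lemma leq_lac_pole k : (P k <= lac_pole k)%N.
Proof.
case: k => [|k]; last by rewrite /lac_pole mulSn -addnA leq_addr.
by have := Psup 0 0; rewrite /= addn0 -{3}[P 0]addn0 leq_add2l.
Qed.

Lemma poles_le_lac : poles_le lac_pole lac.
Proof.
move=> [|k]; first by rewrite /= expr0; exact: (poles_le1 _ _ 0).
apply: pole_leW (pole_le_inv _ s_neq0).
by rewrite /lac_pole mulSn addnAC leq_addl.
Qed.

Variables (y : R) (rho : {rmorphism R -> {poly R}}).
Hypotheses (rho_s : rho s = s%:P) (rhoK : forall p, (rho p).[y] = p).

Lemma fps_subst_lac th : fps_subst s_neq0 rho_s th lac = lac.
Proof.
by apply: fps_subst_id => k; rewrite /= rmorphXn /= loc_rho_inv polyC_exp.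
Qed.

Hypothesis sep : forall p, p != 0 -> exists k, forall q, p != s ^+ k * q.

(** Suppose that [u] is nonzero and vanishes at [y = lac]. Take the least [m]
    such that the [m]-th Hasse derivative of [u] does not vanish at [lac], and
    let [c z^r] be the first term of its value; then [m > 0]. Let [g] be the
    truncation of [lac] after [z^k], so that [g = lac + w] where [w] starts with
    [- s^-a z^(k+1)] for [a = lac_exp (k + 1)]. In the Taylor expansion of
    [u (y := g)] at [lac] the terms of index less than [m] vanish, and those of
    index more than [m] have too high an order; so the coefficient of [z^N], for
    [N = m (k + 1) + r], is exactly [c (- s^-a)^m]. Its pole order is at most
    [P N + N lac_exp k], because the poles of [g] have order at most
    [lac_exp k], and [lac_exp_gap] shows that [a m] exceeds this by more than
    [k]. Hence [c s^-k'] lies in [R] for arbitrarily large [k'], and [c = 0]. *)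
Lemma fps_subst_lac_eq0 (u : {fps A}) :
  poles_le P u -> fps_subst s_neq0 rho_s lac u = 0 -> u = 0.
Proof.
move=> uP u_lac0; apply/eqP/negPn/negP => u_neq0.
have ex_m := fps_hasse_neq0 s_neq0 rho_s rhoK lac u_neq0.
case: (ex_minnP ex_m) => m + mmin; case/fps_neq0P => r cr cr0.
have m_gt0 : (0 < m)%N.
  rewrite lt0n; apply/eqP => m0; case/eqP: cr; rewrite m0.
  rewrite -[RHS](congr1 (fun v => fps_coef v r) u_lac0) fps_substE.
  by apply: eq_bigr => k _; rewrite /= nderivn0.
set c := fps_coef _ r in cr.
case/eqP: cr; apply: (pole_le_div_eq0 s_neq0 sep) => k0.
(* The bounds [m <= k] and [r <= k] ensure [N <= (k + 1) ^ 2]. *)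
pose k := maxn k0 (maxn m r); pose N := (m * k.+1 + r)%N.
have [k0k mk rk] : [/\ (k0 <= k)%N, (m <= k)%N & (r <= k)%N].
  by split; rewrite /k !leq_max leqnn ?orbT.
have Nk : (N <= k.+1 ^ 2)%N.
  apply: (@leq_trans (m.+1 * k.+1)); first by rewrite /N mulSn addnC leq_add2r leqW.
  by rewrite -mulnn leq_mul2r ltnS mk orbT.
pose g : {fps A} := FPS (fun j => if (j <= k)%N then fps_coef lac j else 0).
pose w := g - lac.
have w0 j : (j < k.+1)%N -> fps_coef w j = 0.
  by rewrite ltnS => jk; rewrite fps_coefD fps_coefN /= jk subrr.
have wk : fps_coef w k.+1 = - sV ^+ lac_exp k.+1.
  by rewrite fps_coefD fps_coefN /= ltnn sub0r.
have coefN : fps_coef (fps_subst s_neq0 rho_s g u) N =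
    c * (- sV ^+ lac_exp k.+1) ^+ m.
  have -> : g = lac + w by rewrite addrC subrK.
  pose M := (m.+1 + \max_(j < N.+1)
    size (poly_fpsC s_neq0 rho_s (fps_coef u j)))%N.
  have mM : (m < M)%N by rewrite leq_addr.
  rewrite (@fps_subst_taylor _ _ _ _ _ _ _ _ _ M) => [|j jN]; last first.
    apply: leq_trans (leq_addl _ _).
    exact: (leq_bigmax (Ordinal (jN : (j < N.+1)%N))).
  rewrite (bigD1 (Ordinal mM)) // big1 ?Monoid.mulm1 => [|l]; last first.
    rewrite -val_eqE neq_ltn => /orP[lm|ml].
      have -> : fps_hasse s_neq0 rho_s lac l u = 0.
        by apply/eqP/negPn/negP => /mmin; rewrite leqNgt lm.
      by rewrite mul0r.
    (* For [l > m] the order of [w ^+ l] is at least [l (k + 1) > N]. *)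
    have [_ wl0] := fps_coefX_order l w0.
    have [_] := @fps_coefM_order _ (fps_hasse s_neq0 rho_s lac l u) _ 0
      (l * k.+1) (fun j jn => False_ind _ (notF jn)) wl0; apply.
    apply: leq_trans (leq_mul ml (leqnn _)).
    by rewrite /N mulSn addnC ltn_add2r ltnS.
  have [wmk wm0] := fps_coefX_order m w0.
  have [+ _] := fps_coefM_order cr0 wm0.
  by rewrite wmk wk addnC.
(* A superadditive bound for the poles of both [u] and [g]. *)
pose Q j := (P j + j * lac_exp k)%N.
have Qsup : superadditive Q.
  by move=> i j; rewrite /Q mulnDl addnACA leq_add2r.
have gQ : poles_le Q g.
  move=> j /=; case: leqP => [jk|_]; last exact: pole_le0.
  apply: pole_leW (pole_le_inv _ s_neq0); case: j jk => [|j] jk //.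
  by rewrite /Q mulSn addnCA; apply: leq_trans (leq_addr _ _); exact: lac_exp_homo.
have uQ : poles_le Q u by apply: poles_leW uP => j; exact: leq_addr.
have := poles_le_subst s_neq0 rho_s Qsup gQ uQ N; rewrite coefN.
move=> /(pole_leM (pole_le_to_loc s ((-1) ^+ m))).
rewrite rmorphXn rmorphN rmorph1 [(- sV ^+ _) ^+ _]exprNn [c * _]mulrCA.
rewrite signrMK -exprM add0n => poleN.
have QN : (Q N + k.+1 <= lac_exp k.+1 * m)%N.
  exact: leq_trans (lac_exp_gap Nk) (leq_pmulr _ m_gt0).
exists (lac_exp k.+1 * m - Q N)%N.
  by rewrite leq_subRL ?(leq_trans (leq_addr _ _) QN) //; apply: leq_trans QN;
     rewrite leq_add2l leqW.
case: poleN => q qE; exists q; rewrite -qE mul1r [RHS]mulrCA; congr (_ * _).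
rewrite -{2}(subnKC (leq_trans (leq_addr _ _) QN)) exprD mulrA -exprMn.
by rewrite loc_mulV // expr1n mul1r.
Qed.

End Lacunary.

(** * Prime kernels and the dimension of the generic fiber *)

Section PrimeKernel.
Variables (S T : comNzRingType) (phi : {rmorphism S -> T}).
Hypothesis domT : forall a b : T, a * b = 0 -> a = 0 \/ b = 0.

Definition ker_pred : {pred S} := fun u => phi u == 0.

Fact ker_idealr_closed : idealr_closed ker_pred.
Proof.
split=> [||a u v]; rewrite !unfold_in /= ?rmorph0 ?rmorph1 ?oner_eq0 //.
by move=> /eqP u0 /eqP v0; rewrite rmorphD rmorphM u0 v0 mulr0 addr0.
Qed.
Fact ker_prime_idealr_closed : prime_idealr_closed ker_pred.
Proof.
move=> u v; rewrite !unfold_in rmorphM => /eqP/domT[]->; first by rewrite eqxx.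
by rewrite eqxx orbT.
Qed.
HB.instance Definition _ := isIdealr.Build S ker_pred ker_idealr_closed.
HB.instance Definition _ :=
  isPrimeIdealrClosed.Build S ker_pred ker_prime_idealr_closed.

Definition ker_prime : prime_idealr S := ker_pred.

Lemma in_ker_prime u : (u \in ker_prime) = (phi u == 0).
Proof. by []. Qed.

End PrimeKernel.

(** The supremum of the lengths exists among the extended integers: it is their
    maximum if they are bounded, and [+oo] otherwise. *)
Lemma genericFiberDim_ge (R S : comNzRingType) (phi : {rmorphism R -> S}) n Q :
  @genericFiberChain R S phi n Q -> ((n%:Z)%:E <= genericFiberDim phi)%E.
Proof.
move=> Qchain; rewrite /genericFiberDim /supremum.
set L := (X in if X == _ then _ else _).
have Ln : L (n%:Z)%:E by exists n => //; exists Q.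
case: eqP => [L0|_]; first by rewrite L0 in Ln.
suff [l Ll] : exists l, supremums L l.
  by have [+ _] := xgetPex -oo%E (ex_intro _ l Ll); apply.
have [[b bP]|unb] := pselect (exists b, forall m Q,
    @genericFiberChain R S phi m Q -> (m <= b)%N).
  have exm : exists m, `[< exists Q, @genericFiberChain R S phi m Q >].
    by exists n; apply/asboolP; exists Q.
  have ubm m : `[< exists Q, @genericFiberChain R S phi m Q >] -> (m <= b)%N.
    by move=> /asboolP[Q' /bP].
  case: (ex_maxnP exm ubm) => m /asboolP[Qm Qm_chain] mmax.
  exists (m%:Z)%:E; split=> [_ [k [Q' kQ'] <-]|u]; last first.
    by apply; exists m => //; exists Qm.
  by rewrite lee_fin lez_nat; apply: mmax; apply/asboolP; exists Q'.
exists +oo%E; split=> [x _|u uL]; first exact: leey.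
case: u uL => [u|//|] uL; last by have := uL _ Ln.
case: unb; exists `|u|%N => m Qm Qm_chain.
have /uL : L (m%:Z)%:E by exists m => //; exists Qm.
rewrite lee_fin => mu; rewrite -lez_nat.
exact: le_trans mu (ler_norm _).
Qed.

(** * Polynomials as polynomials in one of their variables *)

Section IsolateVariable.
Variables (K : fieldType) (m : nat).
Local Notation R := {mpoly K[m]}.

Definition isolate_var (i : 'I_m) : {rmorphism R -> {poly R}} :=
  mmap (@polyC R \o @mpolyC m K) (fun j => if j == i then 'X else ('X_j : R)%:P).

Lemma isolate_varX i j :
  isolate_var i 'X_j = if j == i then 'X else ('X_j : R)%:P.
Proof. by rewrite /= mmapX mmap1U. Qed.

Lemma isolate_varK i p : (isolate_var i p).['X_i] = p.
Proof.
rewrite [RHS]mpolyE /= /mmap horner_sum; apply: eq_bigr => mm _.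
rewrite /= hornerCM mul_mpolyC; congr (_ *: _).
rewrite -[RHS]mmap1_id /mmap1 horner_prod; apply: eq_bigr => j _.
by rewrite horner_exp; case: eqP => [->|_]; rewrite ?hornerX ?hornerC.
Qed.

(** The exponent [msize p] exceeds the degree of [p]. *)
Lemma mpolyX_sep (i : 'I_m) (p : R) :
  p != 0 -> exists k, forall q, p != 'X_i ^+ k * q.
Proof.
move=> p0; exists (msize p) => q; apply/eqP => pE.
have [q0 X0] : q != 0 /\ ('X_i : R) ^+ msize p != 0.
  by split; apply: contraNneq p0 => z; rewrite pE z ?mulr0 ?mul0r.
have := congr1 (fun r : R => msize r) pE; rewrite msizeM // mpolyXn msizeX.
rewrite mdegMn mdeg1 mul1n /= => /eqP.
by rewrite -{1}[msize p]addn0 eqn_add2l eq_sym msize_poly_eq0 (negPf q0).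
Qed.

Lemma mpolyXi_neq0 (i : 'I_m) : ('X_i : R) != 0.
Proof. by rewrite -msize_poly_eq0 msizeX. Qed.

End IsolateVariable.

(** * The chain of primes *)

Section Tower.
Variables (K : fieldType) (m : nat).
Local Notation R := {mpoly K[m.+2]}.
Local Notation x := ('X_ord0 : R).
Local Notation S := {fps (loc x)}.

(** The variable [y] of index [t] ranges over [0 <= t <= m]; [inord] only gives
    a default value to the other indices, so that all the sequences below can be
    indexed by [nat] while the variable always differs from [x]. *)
Definition yvar (t : nat) : 'I_m.+2 := lift ord0 (inord t : 'I_m.+1).
Local Notation y t := ('X_(yvar t) : R).

Lemma yvar_inj t1 t2 :
  (t1 <= m)%N -> (t2 <= m)%N -> (yvar t1 == yvar t2) = (t1 == t2).
Proof.
by move=> le1 le2; rewrite (inj_eq lift_inj) -val_eqE /= !inordK.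
Qed.

Lemma isolate_x t : isolate_var K (yvar t) x = x%:P.
Proof. by rewrite isolate_varX (negPf (neq_lift _ _)). Qed.

(** Bounds for the poles after the first [t] substitutions, starting from series
    without poles. *)
Fixpoint tower_pole (t : nat) : nat -> nat :=
  if t is i.+1 then lac_pole (tower_pole i) else fun=> 0%N.

Lemma tower_pole_superadditive t : superadditive (tower_pole t).
Proof. by elim: t => [//|t IH]; apply: lac_pole_superadditive. Qed.

Definition tower_series (t : nat) : S := lac x (tower_pole t).

Definition tower_subst (t : nat) : {rmorphism S -> S} :=
  fps_subst (mpolyXi_neq0 K ord0) (isolate_x t) (tower_series t).

(** The composite of the substitutions of index less than [t]. *)
Fixpoint tower (t : nat) : {rmorphism S -> S} :=
  if t is i.+1 then tower_subst i \o tower i else idfun.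

Lemma towerS t u : tower t.+1 u = tower_subst t (tower t u).
Proof. by []. Qed.

Lemma poles_le_tower_subst t u :
  poles_le (tower_pole t) u -> poles_le (tower_pole t.+1) (tower_subst t u).
Proof.
move=> uP; have Psup := tower_pole_superadditive t.
apply: (poles_le_subst _ _ (lac_pole_superadditive Psup)).
  exact: (poles_le_lac (mpolyXi_neq0 K ord0)).
by apply: poles_leW uP => k; exact: leq_lac_pole.
Qed.

Lemma tower_subst_inj t u :
  poles_le (tower_pole t) u -> tower_subst t u = 0 -> u = 0.
Proof.
move=> uP; apply: (fps_subst_lac_eq0 (tower_pole_superadditive t) _ _ uP).
  exact: isolate_varK.
exact: mpolyX_sep.
Qed.

Lemma poles_le_tower t (u : {fps R}) :
  poles_le (tower_pole t) (tower t (fps_map (to_loc x) u)).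
Proof.
elim: t => [|t IH]; first by move=> k; apply: pole_le_to_loc.
by rewrite towerS; apply: poles_le_tower_subst.
Qed.

(** The series for [y t] is chosen after a bound for the poles produced by the
    previous substitutions is known, so each substitution kills no nonzero
    element of the image of [R[[z]]]. *)
Lemma tower_inj t (u : {fps R}) :
  tower t (fps_map (to_loc x) u) = 0 -> u = 0.
Proof.
elim: t => [|t IH] u0.
  by apply: (fps_map_inj (@to_loc_inj _ x)); rewrite [LHS]u0 rmorph0.
by apply/IH/(tower_subst_inj (poles_le_tower _ _)).
Qed.

(** The witness of strictness: it is killed by the substitution of index [t] and
    fixed by the previous ones. *)
Definition tower_gap (t : nat) : S := fpsC (to_loc x (y t)) - tower_series t.

Lemma tower_subst_series t1 t2 :
  tower_subst t1 (tower_series t2) = tower_series t2.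
Proof. exact: fps_subst_lac. Qed.

Lemma tower_subst_gap t : tower_subst t (tower_gap t) = 0.
Proof.
have gapE : tower_subst t (fpsC (to_loc x (y t))) = tower_series t.
  by apply: fps_subst_var; rewrite isolate_varX eqxx.
by rewrite rmorphB gapE tower_subst_series subrr.
Qed.

Lemma tower_subst_gap_id t1 t2 : (t1 < t2)%N -> (t2 <= m)%N ->
  tower_subst t1 (tower_gap t2) = tower_gap t2.
Proof.
move=> lt12 le2.
have yE : tower_subst t1 (fpsC (to_loc x (y t2))) = fpsC (to_loc x (y t2)).
  apply: fps_substC; rewrite loc_rho_to_loc isolate_varX.
  by rewrite yvar_inj ?(leq_trans (ltnW lt12)) // gtn_eqF // map_polyC.
by rewrite rmorphB yE tower_subst_series.
Qed.

Lemma tower_gap_id t1 t2 : (t1 <= t2)%N -> (t2 <= m)%N ->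
  tower t1 (tower_gap t2) = tower_gap t2.
Proof.
elim: t1 => [//|t1 IH] lt12 le2.
by rewrite towerS (IH (ltnW lt12) le2); apply: tower_subst_gap_id.
Qed.

(** The constant term is [y t - 1], because [lac_exp 0 = 0]. *)
Lemma tower_gap_neq0 t : tower_gap t != 0.
Proof.
apply/eqP => /(congr1 (fun f => fps_coef f 0)) /= /eqP.
rewrite expr0 -(rmorph1 (to_loc x)) -rmorphB.
rewrite -(rmorph0 (to_loc x)) => /eqP/to_loc_inj/eqP; rewrite subr_eq0.
by move=> /eqP/(congr1 (fun r : R => msize r)); rewrite msizeX mdeg1 msize1.
Qed.

Lemma tower_ker_le t1 t2 u : (t1 <= t2)%N -> tower t1 u = 0 -> tower t2 u = 0.
Proof.
move=> /subnKC <-; elim: (t2 - t1)%N => [|d IH] u0; first by rewrite addn0.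
by rewrite addnS towerS (IH u0) rmorph0.
Qed.

Definition fps_loc_integral := fps_integral (@loc_integral _ x).

Lemma tower_chain : @genericFiberChain _ _ (fps_map (to_loc x)) m.+1
  (fun t => ker_prime (tower t) fps_loc_integral).
Proof.
split=> [t|t1 t2 lt12].
  apply/seteqP; split=> u /=; rewrite (in_ker_prime _ fps_loc_integral).
    by move=> /eqP /tower_inj.
  by move=> ->; rewrite !rmorph0.
have le1 : (t1 <= m)%N by rewrite -ltnS (leq_trans lt12) // -ltnS.
split=> [u|/(_ (tower_gap t1))]; rewrite /= !(in_ker_prime _ fps_loc_integral).
  by move=> /eqP/(tower_ker_le (ltnW lt12))->.
rewrite (tower_gap_id (leqnn t1) le1) (negPf (tower_gap_neq0 _)) => gap_ker.
suff: false by []; apply: gap_ker; apply/eqP; apply: (tower_ker_le lt12).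
by rewrite towerS tower_gap_id // tower_subst_gap.
Qed.

End Tower.

(* In {mpoly K[n.+1]}, the variable x is 'X_ord0, and y_1, ..., y_n are the
   remaining n variables. *)
Theorem mainTheorem4 (K : fieldType) (n : nat) (hn : (1 <= n)%N) :
  ((n%:Z)%:E <= genericFiberDim
     (fps_map (to_loc ('X_ord0 : {mpoly K[n.+1]}))))%E.
Proof.
case: n hn => // m _; exact: genericFiberDim_ge (tower_chain K m).
Qed.
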